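(* Let $\Theta$ be a finite set, $(\pi,A)$ a decision problem, $(N,\nu)$ a nest structure for $\pi$, $\zeta,\eta>0$, and let costs be posterior-separable with the nested Shannon entropy $$H_\pi(p)=\min\Big\{\zeta D_{\mathrm{KL}}(\bar\mu\Vert\bar\nu)+\eta\sum_{i\in N}\bar\mu(i)D_{\mathrm{KL}}(\mu_i\Vert\nu_i):\ \mu\in\Delta(N\times\Theta)\text{ with marginal }p\text{ on }\Theta\Big\}.$$ Let $P\in\Delta(A)^\Theta$ be an optimal choice rule generated by a saddle point $(P_\pi,\lambda)$, let $\lambda_\pi=(\lambda(\theta)/\pi(\theta))_{\theta\in\Theta}$, and let $a\in\operatorname{supp}P_\pi$ with associated posterior belief $p_a=\nabla H^\star_\pi(a-\lambda_\pi)\in\Delta(\Theta)$. Then the minimum defining $H_\pi(p_a)$ is achieved by the joint belief $\mu_a\in\Delta(N\times\Theta)$ whose marginal distribution $\bar\mu_a\in\Delta(N)$ over nests is $$\bar\mu_a(i)=\frac{\bar\nu(i)\Big(\sum_{\tau\in\Theta}\nu_i(\tau)e^{\frac{a(\tau)-\lambda_\pi(\tau)}{\eta}}\Big)^{\eta/\zeta}}{\sum_{j\in N}\bar\nu(j)\Big(\sum_{\tau\in\Theta}\nu_j(\tau)e^{\frac{a(\tau)-\lambda_\pi(\tau)}{\eta}}\Big)^{\eta/\zeta}}\qquad\forall i\in N,$$ and whose nest-contingent conditional distributions $\mu_{(a,i)}\in\Delta(\Theta)$ over states are $$\mu_{(a,i)}(\theta)=\frac{\nu_i(\theta)e^{\frac{a(\theta)-\lambda_\pi(\theta)}{\eta}}}{\sum_{\tau\in\Theta}\nu_i(\tau)e^{\frac{a(\tau)-\lambda_\pi(\tau)}{\eta}}}\qquad\forall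 i\in N,\ \theta\in\Theta.$$
   Context: A decision problem $(\pi,A)$: full-support prior $\pi\in\Delta(\Theta)$, finite nonempty $A\subset\mathbb{R}^\Theta$. A nest structure $(N,\nu)$ for $\pi$ consists of a finite set $N$ and a joint distribution $\nu\in\Delta(N\times\Theta)$ whose marginal on $N$ has full support and whose marginal on $\Theta$ is $\pi$. For $\mu\in\Delta(N\times\Theta)$, $\bar\mu\in\Delta(N)$ denotes its marginal on $N$ and $\mu_i\in\Delta(\Theta)$ the conditional distribution on $\Theta$ given $i\in N$ (terms with $\bar\mu(i)=0$ contribute $0$); similarly $\bar\nu,\nu_i$. $D_{\mathrm{KL}}(\beta\Vert\alpha)=\sum_x\beta(x)\log(\beta(x)/\alpha(x))$, equal to $+\infty$ if $\beta$ is not absolutely continuous with respect to $\alpha$. Posterior-separable cost: $C(P,\pi)=\sum_{a\in\operatorname{supp}P_\pi}P_\pi(a)H_\pi(p_a)$, with $P_\pi=\sum_\theta\pi(\theta)P_\theta$ and $p_a(\theta)=\pi(\theta)P_\theta(a)/P_\pi(a)$. $P$ is optimal if it maximizes $\sum_\theta\pi(\theta)\sum_aP_\theta(a)a(\theta)-C(P,\pi)$ over $\Delta(A)^\Theta$. With $H^\star_\pi(x)=\max_{p\in\Delta(\Theta)}\sum_\theta x(\theta)p(\theta)-H_\pi(p)$ (finite and differentiable), an optimal $P$ is generated by a saddle point $(\alpha,\lambda)\in\Delta(A)\times\mathbb{R}^\Theta$ (maximum over $\alpha$, minimum over $\lambda$) of $\sum_a\alpha(a)H^\star_\pi(a-\lambda_\pi)+\sum_\theta\lambda(\theta)$,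 where $\lambda_\pi(\theta)=\lambda(\theta)/\pi(\theta)$, if $P_\theta(a)=\alpha(a)\nabla_\theta H_\pi^\star(a-\lambda_\pi)/\pi(\theta)$ for all $\theta,a$; in that case $\alpha=P_\pi$ and $p_a=\nabla H_\pi^\star(a-\lambda_\pi)$ for $a\in\operatorname{supp}P_\pi$. *)

(* Defs.v *)
From HB Require Import structures.
From mathcomp Require Import all_boot all_order all_algebra.
From mathcomp Require Import finmap.
From mathcomp Require Import all_classical all_reals all_analysis.

Set Implicit Arguments.
Unset Strict Implicit.
Unset Printing Implicit Defensive.
Import Order.TTheory GRing.Theory Num.Theory.
Local Open Scope classical_set_scope.
Local Open Scope ring_scope.

Section Distributions.
Variable R : realType.

Definition is_dist (T : finType) (f : T -> R) : Prop :=
  (forall x, 0 <= f x) /\ \sum_x f x = 1.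

Definition full_support (T : finType) (f : T -> R) : Prop :=
  forall x, 0 < f x.

(* [DKL b a] is the divergence written D_KL(b || a).  The summands with
   [b x = 0] vanish, and [a x = 0] forces [b x = 0] in the finite branch. *)
Definition DKL (T : finType) (b a : T -> R) : \bar R :=
  if [forall x, (a x == 0) ==> (b x == 0)]
  then (\sum_x b x * ln (b x / a x))%:E
  else +oo%E.

End Distributions.

Section Nests.
Variables (R : realType) (N Theta : finType).
Implicit Types (mu nu : N * Theta -> R) (p pi : Theta -> R).

Definition nest_marginal mu (i : N) : R := \sum_theta mu (i, theta).

Definition state_marginal mu (theta : Theta) : R := \sum_i mu (i, theta).

(* Since [x / 0 = 0], this is the zero function when nest [i] has probability
   [0]; only the case of positive probability is meaningful. *)
Definition nest_conditional mu (i : N) (theta : Theta) : R :=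
  mu (i, theta) / nest_marginal mu i.

Definition nest_structure pi nu : Prop :=
  [/\ is_dist nu, full_support (nest_marginal nu) & state_marginal nu =1 pi].

(* Nests with [nest_marginal mu i = 0] contribute [0], as [0 * x = 0] for every
   extended real [x]. *)
Definition nested_cost (zeta eta : R) nu mu : \bar R :=
  (zeta%:E * DKL (nest_marginal mu) (nest_marginal nu) +
   eta%:E * \sum_i (nest_marginal mu i)%:E *
              DKL (nest_conditional mu i) (nest_conditional nu i))%E.

Definition joint_beliefs p : set (N * Theta -> R) :=
  [set mu | is_dist mu /\ state_marginal mu =1 p].

Definition nested_entropy (zeta eta : R) nu p : \bar R :=
  ereal_inf [set nested_cost zeta eta nu mu | mu in joint_beliefs p].

End Nests.

Section DecisionProblem.
Variables (R : realType) (Theta : finType).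

(* An action is a payoff vector [a : {ffun Theta -> R}]; a finite set of actions
   [A : {fset {ffun Theta -> R}}] is itself used as the finite type of its
   elements. *)
Definition decision_problem (pi : Theta -> R) (A : {fset {ffun Theta -> R}}) :
    Prop :=
  [/\ is_dist pi, full_support pi & A != fset0].

Variables (pi : Theta -> R) (A : {fset {ffun Theta -> R}}).
(* [H] is the cost function H_pi on Delta(Theta), allowed to be infinite. *)
Variable H : (Theta -> R) -> \bar R.
Implicit Types (P : Theta -> A -> R) (alpha : A -> R) (lambda x : Theta -> R).

Definition is_choice_rule P : Prop := forall theta, is_dist (P theta).

Definition choice_marginal P (a : A) : R := \sum_theta pi theta * P theta a.

Definition posterior P (a : A) (theta : Theta) : R :=
  pi theta * P theta a / choice_marginal P a.

Definition ps_cost P : \bar R :=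
  (\sum_(a : A | (0 < choice_marginal P a)%R)
     (choice_marginal P a)%:E * H (posterior P a))%E.

Definition net_payoff P : \bar R :=
  ((\sum_theta pi theta * \sum_(a : A) P theta a * val a theta)%:E -
   ps_cost P)%E.

Definition is_optimal P : Prop :=
  is_choice_rule P /\
  forall Q, is_choice_rule Q -> (net_payoff Q <= net_payoff P)%E.

Definition conjugate x : \bar R :=
  ereal_sup [set ((\sum_theta x theta * p theta)%:E - H p)%E
            | p in [set p : Theta -> R | is_dist p]].

Definition gradient (f : (Theta -> R) -> R) x (theta : Theta) : R :=
  (fun t : R => f (fun tau => x tau + t * (tau == theta)%:R))^`()%classic 0.

Definition grad_conjugate x : Theta -> R := gradient (fine \o conjugate) x.

Definition normalized lambda (theta : Theta) : R := lambda theta / pi theta.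

Definition shifted_payoff (a : A) lambda (theta : Theta) : R :=
  val a theta - normalized lambda theta.

Definition lagrangian alpha lambda : \bar R :=
  (\sum_(a : A) (alpha a)%:E * conjugate (shifted_payoff a lambda) +
   (\sum_theta lambda theta)%R%:E)%E.

Definition is_saddle_point alpha lambda : Prop :=
  [/\ is_dist alpha,
      forall beta : A -> R, is_dist beta ->
        (lagrangian beta lambda <= lagrangian alpha lambda)%E
    & forall lambda' : Theta -> R,
        (lagrangian alpha lambda <= lagrangian alpha lambda')%E].

Definition generated_by P alpha lambda : Prop :=
  is_saddle_point alpha lambda /\
  forall theta a,
    P theta a =
      alpha a * grad_conjugate (shifted_payoff a lambda) theta / pi theta.

Lemma posterior_grad P lambda (a : A) :
  full_support pi -> generated_by P (choice_marginal P) lambda ->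
  0 < choice_marginal P a ->
  posterior P a =1 grad_conjugate (shifted_payoff a lambda).
Proof.
move=> pi_gt0 [_ genP] Pa_gt0 theta; rewrite /posterior genP.
rewrite mulrCA divff ?(gt_eqF (pi_gt0 theta))// mulr1.
by rewrite mulrAC divff ?gt_eqF// mul1r.
Qed.

End DecisionProblem.

(* Main.v *)
(* By the Gibbs variational principle, <c, b> - D_KL(b || a) is maximal, with
   value ln (\sum_x a x e^(c x)), at the exponential tilt of a by c.  Applied
   within each nest to x / eta and then across nests to (eta / zeta) ln Z_i,
   where Z_i is the partition function of nest i, it shows that
   <x, marginal of mu> - cost(mu) has maximum
   zeta ln (\sum_i nubar_i Z_i^(eta / zeta)), attained at the two-stage tilt.
   Hence this is the conjugate of the nested entropy; its gradient is the state
   marginal of the two-stage tilt, which at x = a - lambda_pi must therefore be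
   p_a.  Any other joint belief with marginal p_a pairs with x to the same
   number, so it costs at least as much. *)
Require Import Defs.
From HB Require Import structures.
From mathcomp Require Import all_boot all_order all_algebra.
From mathcomp Require Import finmap.
From mathcomp Require Import all_classical all_reals all_analysis.
From mathcomp Require Import ring.

Set Implicit Arguments.
Unset Strict Implicit.
Unset Printing Implicit Defensive.
Import Order.TTheory GRing.Theory Num.Theory.
Local Open Scope ring_scope.

(** * Differentiation rules and a logarithm inequality *)

Lemma is_derive_fsum (R : realType) (I : Type) (r : seq I) (F : I -> R -> R)
    (dF : I -> R) (t : R) :
  (forall i, is_derive t 1 (F i) (dF i)) ->
  is_derive t 1 (fun s => \sum_(i <- r) F i s) (\sum_(i <- r) dF i).
Proof.
move=> derF; elim: r => [|i r IHr].
  under eq_fun do rewrite big_nil; rewrite big_nil; exact: is_derive_cst.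
under eq_fun do rewrite big_cons; rewrite big_cons; exact: is_deriveD.
Qed.

Lemma is_derive_scale (R : realType) (k : R) (f : R -> R) (df t : R) :
  is_derive t 1 f df -> is_derive t 1 (fun s => k * f s) (k * df).
Proof. exact: is_deriveZ. Qed.

Lemma is_derive_ln_comp (R : realType) (f : R -> R) (df t : R) :
  0 < f t -> is_derive t 1 f df ->
  is_derive t 1 (fun s => ln (f s)) ((f t)^-1 * df).
Proof. by move=> /is_derive1_ln dln df_t; exact: (is_derive1_comp dln df_t). Qed.

Lemma ln_le_subr1 (R : realType) (y : R) : 0 < y -> ln y <= y - 1.
Proof.
by move=> y_gt0; rewrite -{1}[y](subrKC 1) le_ln1Dx// ltrBrDr addNr.
Qed.

(** * The Gibbs variational principle *)

Section Tilting.
Variables (R : realType) (T : finType).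
Implicit Types a b c : T -> R.

Definition partition a c : R := \sum_x a x * expR (c x).

Definition tilt a c (x : T) : R := a x * expR (c x) / partition a c.

(** Some weights [a x] may vanish, but a zero sum of nonnegative terms would make all of them
    vanish, against total mass 1. *)
Lemma partition_gt0 a c : is_dist a -> 0 < partition a c.
Proof.
move=> [a_ge0 a1]; have t_ge0 x : 0 <= a x * expR (c x).
  by rewrite mulr_ge0// expR_ge0.
rewrite lt_neqAle sumr_ge0// andbT; apply/negP => /eqP/esym/eqP.
rewrite psumr_eq0// => /allP a0; have /eqP := @oner_neq0 R; apply.
rewrite -a1 big1// => x _.
by have := a0 x (mem_index_enum x); rewrite mulf_eq0 (gt_eqF (expR_gt0 _)) orbF => /eqP.
Qed.

Lemma tilt_dist a c : is_dist a -> is_dist (tilt a c).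
Proof.
move=> da; have Z_gt0 := partition_gt0 c da; split=> [x|].
  by rewrite divr_ge0 ?mulr_ge0 ?expR_ge0 ?(ltW Z_gt0)//; apply da.1.
by rewrite -mulr_suml divff ?gt_eqF.
Qed.

(** Termwise [ln y <= y - 1] at [y = tilt a c x / b x], weighted by [b x]; the right-hand sides sum
    to 0 because [tilt a c] and [b] both have mass 1. *)
Lemma gibbs_le a b c : is_dist a -> is_dist b ->
  ((\sum_x b x * c x - ln (partition a c))%:E <= DKL b a)%E.
Proof.
move=> da db; rewrite /DKL; case: ifP => [/forallP ac|_]; last exact: leey.
have Z_gt0 := partition_gt0 c da; rewrite lee_fin -subr_le0.
have -> : \sum_x b x * c x - ln (partition a c) - \sum_x b x * ln (b x / a x) =
    \sum_x (b x * c x - b x * ln (partition a c) - b x * ln (b x / a x)).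
  by rewrite !sumrB -mulr_suml db.2 mul1r.
have t0 : \sum_x (tilt a c x - b x) = 0.
  by rewrite sumrB (tilt_dist c da).2 db.2 subrr.
rewrite -[leRHS]t0; apply: ler_sum => x _; have := db.1 x.
rewrite le_eqVlt => /orP[/eqP <-|b_gt0].
  by rewrite !mul0r !subr0; apply: (tilt_dist c da).1.
(* The finite branch of [DKL] provides absolute continuity. *)
have a_gt0 : 0 < a x.
  have := da.1 x; rewrite le_eqVlt eq_sym => /orP[a0|//].
  by move: (ac x); rewrite a0/= gt_eqF.
have y_gt0 : 0 < tilt a c x / b x.
  by rewrite !divr_gt0 ?mulr_gt0 ?expR_gt0.
have -> : tilt a c x - b x = b x * (tilt a c x / b x - 1).
  by rewrite mulrBr mulr1 mulrC divfK ?gt_eqF.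
rewrite -!mulrBr ler_pM2l//; apply: le_trans (ln_le_subr1 y_gt0).
rewrite /tilt !ln_div ?posrE ?divr_gt0 ?mulr_gt0 ?expR_gt0//.
rewrite lnM ?posrE ?expR_gt0// expRK le_eqVlt; apply/orP; left; apply/eqP.
by ring.
Qed.

(** Wherever [a x > 0], the log-ratio [ln (tilt a c x / a x)] is exactly
    [c x - ln (partition a c)]. *)
Lemma gibbs_eq a c : is_dist a ->
  DKL (tilt a c) a =
  (\sum_x tilt a c x * c x - ln (partition a c))%:E.
Proof.
move=> da; have Z_gt0 := partition_gt0 c da; rewrite /DKL ifT; last first.
  by apply/forallP => x; apply/implyP => /eqP a0; rewrite /tilt a0 !mul0r.
congr EFin; rewrite -[ln _]mul1r -(tilt_dist c da).2 mulr_suml -sumrB.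
apply: eq_bigr => x _; have := da.1 x; rewrite le_eqVlt => /orP[/eqP a0|a_gt0].
  by rewrite /tilt -a0 !mul0r subr0.
rewrite -mulrBr; congr (_ * _).
have -> : tilt a c x / a x = expR (c x) / partition a c.
  by rewrite /tilt mulrAC [a x * _]mulrC mulfK ?gt_eqF.
by rewrite ln_div ?posrE ?expR_gt0// expRK.
Qed.

End Tilting.

(** * Nest decomposition and the two-stage tilt *)

Section NestedConjugate.
Variables (R : realType) (N Theta : finType).
Implicit Types (mu nu : N * Theta -> R) (x p : Theta -> R).

Lemma nest_marginal_ge0 mu i : is_dist mu -> 0 <= nest_marginal mu i.
Proof. by move=> [mu_ge0 _]; apply: sumr_ge0. Qed.

Lemma nest_marginal_dist mu : is_dist mu -> is_dist (nest_marginal mu).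
Proof.
move=> dmu; split=> [i|]; first exact: nest_marginal_ge0.
by rewrite pair_bigA -[RHS]dmu.2; apply: eq_bigr => -[].
Qed.

Lemma nest_conditional_dist mu i :
  is_dist mu -> 0 < nest_marginal mu i -> is_dist (nest_conditional mu i).
Proof.
move=> [mu_ge0 _] mui; split=> [theta|]; first by rewrite divr_ge0// ltW.
by rewrite -mulr_suml divff ?gt_eqF.
Qed.

Lemma nest_marginalM_conditional mu i theta : is_dist mu ->
  nest_marginal mu i * nest_conditional mu i theta = mu (i, theta).
Proof.
move=> dmu; rewrite /nest_conditional.
(* In a nest of probability 0 the quotient is 0 by convention, but nonnegativity makes [mu] vanish
   on that nest too. *)
have [mui0|mui0] := eqVneq (nest_marginal mu i) 0; last by rewrite mulrC divfK.
rewrite mui0 mul0r; apply/esym/eqP; move/eqP: mui0.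
rewrite psumr_eq0; last by move=> ? _; apply: dmu.1.
by move/allP => /(_ theta (mem_index_enum theta)).
Qed.

Lemma pairing_state_marginal mu x : is_dist mu ->
  \sum_theta x theta * state_marginal mu theta =
  \sum_i nest_marginal mu i * \sum_theta nest_conditional mu i theta * x theta.
Proof.
move=> dmu; under eq_bigr do rewrite /state_marginal mulr_sumr; rewrite exchange_big.
apply: eq_bigr => i _; rewrite mulr_sumr; apply: eq_bigr => theta _.
by rewrite mulrA nest_marginalM_conditional// mulrC.
Qed.

Variables (nu : N * Theta -> R) (zeta eta : R).
Hypotheses (dnu : is_dist nu) (fnu : full_support (nest_marginal nu)).
Hypotheses (zeta_gt0 : 0 < zeta) (eta_gt0 : 0 < eta).

Definition nest_partition x (i : N) : R :=
  partition (nest_conditional nu i) (fun theta => x theta / eta).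

(** [eta * ln Z_i] is the maximal value attainable inside nest [i]; dividing by [zeta] makes it the
    exponent of the outer tilt, with exponential [Z_i^(eta / zeta)]. *)
Definition nest_value x (i : N) : R := eta / zeta * ln (nest_partition x i).

Definition nested_partition x : R :=
  partition (nest_marginal nu) (nest_value x).

Definition nested_tilt x (it : N * Theta) : R :=
  tilt (nest_marginal nu) (nest_value x) it.1 *
  tilt (nest_conditional nu it.1) (fun theta => x theta / eta) it.2.

Let dnui i : is_dist (nest_conditional nu i).
Proof. exact: nest_conditional_dist. Qed.

Let dnubar : is_dist (nest_marginal nu).
Proof. exact: nest_marginal_dist. Qed.

Lemma nest_partition_gt0 x i : 0 < nest_partition x i.
Proof. exact: partition_gt0. Qed.

Lemma nested_partition_gt0 x : 0 < nested_partition x.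
Proof. exact: partition_gt0. Qed.

Lemma nest_marginal_tilt x :
  nest_marginal (nested_tilt x) = tilt (nest_marginal nu) (nest_value x).
Proof.
by apply/funext => i; rewrite /nest_marginal /nested_tilt/= -mulr_sumr (tilt_dist _ (dnui i)).2 mulr1.
Qed.

Lemma nest_marginal_tilt_gt0 x i : 0 < nest_marginal (nested_tilt x) i.
Proof.
by rewrite nest_marginal_tilt divr_gt0 ?mulr_gt0 ?expR_gt0 ?nested_partition_gt0.
Qed.

Lemma nest_conditional_tilt x i : nest_conditional (nested_tilt x) i =
  tilt (nest_conditional nu i) (fun theta => x theta / eta).
Proof.
apply/funext => theta; rewrite /nest_conditional nest_marginal_tilt /nested_tilt/=.
by rewrite mulrAC divff ?mul1r// -nest_marginal_tilt gt_eqF// nest_marginal_tilt_gt0.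
Qed.

Lemma nested_tilt_dist x : is_dist (nested_tilt x).
Proof.
split=> [it|].
  by rewrite mulr_ge0//; [apply: (tilt_dist _ dnubar).1|apply: (tilt_dist _ (dnui _)).1].
rewrite -(pair_bigA _ (fun i theta => nested_tilt x (i, theta)))/=.
by rewrite -[RHS](tilt_dist (nest_value x) dnubar).2 -nest_marginal_tilt.
Qed.

Lemma state_marginal_dist mu : is_dist mu -> is_dist (state_marginal mu).
Proof.
move=> [mu_ge0 mu1]; split=> [theta|]; first exact: sumr_ge0.
by rewrite exchange_big pair_bigA -[RHS]mu1; apply: eq_bigr => -[].
Qed.

(* The two-stage Gibbs bound [<x, p> - zeta ln S], regrouped nest by nest. *)
Lemma two_stage_bound mu x : is_dist mu ->
  \sum_theta x theta * state_marginal mu theta - zeta * ln (nested_partition x) =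
  zeta * (\sum_i nest_marginal mu i * nest_value x i - ln (nested_partition x)) +
  eta * \sum_i nest_marginal mu i *
    (\sum_theta nest_conditional mu i theta * (x theta / eta)
     - ln (nest_partition x i)).
Proof.
move=> dmu; rewrite pairing_state_marginal// mulrBr addrAC; congr (_ - _).
rewrite !mulr_sumr -big_split/=; apply: eq_bigr => i _.
rewrite /nest_value; under [in RHS]eq_bigr do rewrite mulrA.
rewrite -mulr_suml; set K := \sum_theta _; set L := ln _.
have z0 : zeta != 0 by rewrite gt_eqF.
have e0 : eta != 0 by rewrite gt_eqF.
by field; rewrite e0 z0.
Qed.

(** * Bounds for the nested cost and entropy *)

Lemma nested_cost_ge mu x : is_dist mu ->
  ((\sum_theta x theta * state_marginal mu theta
    - zeta * ln (nested_partition x))%:E <= nested_cost zeta eta nu mu)%E.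
Proof.
move=> dmu; rewrite two_stage_bound// EFinD !EFinM leeD//.
  apply: lee_wpmul2l; first by rewrite lee_fin ltW.
  apply: gibbs_le => //.
  exact: nest_marginal_dist.
apply: lee_wpmul2l; first by rewrite lee_fin ltW.
rewrite -sumEFin; apply: lee_sum => i _.
rewrite EFinM; have := nest_marginal_ge0 i dmu; rewrite le_eqVlt => /orP[/eqP <-|mui].
  (* For a null nest the conditional is the zero function, to which [gibbs_le] does not apply; the
     weight 0 removes both sides. *)
  by rewrite !mul0e.
apply: lee_wpmul2l; first by rewrite lee_fin ltW.
apply: gibbs_le => //.
exact: nest_conditional_dist.
Qed.

(** The bound of [nested_cost_ge] sees [mu] only through its state marginal, so it passes to the
    infimum over joint beliefs. *)
Lemma nested_entropy_ge x p :
  ((\sum_theta x theta * p theta - zeta * ln (nested_partition x))%:E <=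
   nested_entropy zeta eta nu p)%E.
Proof.
apply: le_ereal_inf_tmp => _ [mu [dmu mu_p] <-].
apply: le_trans (nested_cost_ge x dmu).
by rewrite lee_fin; under [in X in _ <= X]eq_bigr do rewrite mu_p.
Qed.

(** Both stages of the Gibbs bound are equalities here, since the nest marginal and the conditionals
    are themselves tilts. *)
Lemma nested_cost_tilt x :
  nested_cost zeta eta nu (nested_tilt x) =
  (\sum_theta x theta * state_marginal (nested_tilt x) theta
   - zeta * ln (nested_partition x))%:E.
Proof.
rewrite two_stage_bound; last exact: nested_tilt_dist.
rewrite /nested_cost nest_marginal_tilt gibbs_eq// [RHS]EFinD !EFinM -sumEFin.
congr (_ + _ * _)%E; apply: eq_bigr => i _.
by rewrite EFinM nest_conditional_tilt gibbs_eq.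
Qed.

Lemma nested_entropy_tilt x :
  nested_entropy zeta eta nu (state_marginal (nested_tilt x)) =
  nested_cost zeta eta nu (nested_tilt x).
Proof.
apply/eqP; rewrite eq_le; apply/andP; split.
  apply: ereal_inf_lbound; exists (nested_tilt x) => //.
  by split=> //; exact: nested_tilt_dist.
by rewrite nested_cost_tilt nested_entropy_ge.
Qed.

(** * The conjugate and its gradient *)

Lemma conjugate_nested_entropy x :
  conjugate (nested_entropy zeta eta nu) x =
  (zeta * ln (nested_partition x))%:E.
Proof.
apply/eqP; rewrite eq_le; apply/andP; split.
  apply: ge_ereal_sup => _ [p _ <-]; rewrite lee_subel_addr//.
  set s := \sum_theta _; set M := zeta * _.
  rewrite -[s](subrKC M) EFinD; apply: leeD2l.
  exact: nested_entropy_ge.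
apply: ereal_sup_ubound; exists (state_marginal (nested_tilt x)).
  by apply: state_marginal_dist; exact: nested_tilt_dist.
rewrite nested_entropy_tilt nested_cost_tilt -EFinB; congr EFin.
by rewrite opprB addrC subrK.
Qed.

(** Chain rule through the outer and inner partition functions: the factors [zeta], [eta / zeta] and
    [1 / eta] cancel, leaving the tilt probabilities summed over nests. *)
Lemma is_derive_ln_nested_partition x theta :
  is_derive (0 : R) 1
    (fun t => zeta * ln (nested_partition (fun tau => x tau + t * (tau == theta)%:R)))
    (state_marginal (nested_tilt x) theta).
Proof.
pose xt t tau := x tau + t * (tau == theta)%:R.
have xt0 : xt 0 = x by apply/funext => tau; rewrite /xt mul0r addr0.
have dZ i : is_derive (0 : R) 1 (fun t => nest_partition (xt t) i)
    (nest_conditional nu i theta * (expR (x theta / eta) / eta)).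
  (* Only coordinate [theta] moves, so one summand survives. *)
  have -> : nest_conditional nu i theta * (expR (x theta / eta) / eta) =
    \sum_tau nest_conditional nu i tau *
      (expR (xt 0 tau / eta) * (eta^-1 * (tau == theta)%:R)).
    rewrite xt0 (bigD1 theta)//= eqxx mulr1 big1 ?addr0// => tau /negPf ->.
    by rewrite !mulr0.
  apply: is_derive_fsum => tau; apply: is_derive_scale.
  apply: (@is_derive1_comp _ expR (fun t => xt t tau / eta)).
  have -> : (fun t => xt t tau / eta) =
      cst (x tau / eta) + (fun t => (eta^-1 * (tau == theta)%:R) * t).
    apply/funext => t; rewrite /xt -[RHS]/(_ + _).
    by rewrite /cst; ring.
  rewrite -[X in is_derive _ _ _ X]add0r.
  apply: is_deriveD; rewrite -[X in is_derive _ _ _ X]mulr1.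
  exact: is_derive_scale.
have dS : is_derive (0 : R) 1 (fun t => nested_partition (xt t))
    (\sum_i nest_marginal nu i * (expR (nest_value x i) *
      (eta / zeta * ((nest_partition x i)^-1 *
        (nest_conditional nu i theta * (expR (x theta / eta) / eta)))))).
  apply: is_derive_fsum => i; apply: is_derive_scale.
  (* The outer derivative must be read at the path's value at time 0, hence [x] is rewritten as
     [xt 0]. *)
  rewrite -{1}xt0.
  apply: (@is_derive1_comp _ expR (fun t => nest_value (xt t) i)).
  rewrite -{1}xt0; apply: is_derive_scale; apply: is_derive_ln_comp (dZ i).
  by rewrite xt0 nest_partition_gt0.
have -> : state_marginal (nested_tilt x) theta =
    zeta * ((nested_partition x)^-1 * \sum_i nest_marginal nu i * (expR (nest_value x i) *
      (eta / zeta * ((nest_partition x i)^-1 *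
        (nest_conditional nu i theta * (expR (x theta / eta) / eta)))))).
  rewrite !mulr_sumr; apply: eq_bigr => i _.
  rewrite /nested_tilt /tilt/= -/(nested_partition x) -/(nest_partition x i).
  by field; rewrite !gt_eqF ?nest_partition_gt0 ?nested_partition_gt0.
rewrite -{2}xt0; apply: is_derive_scale; apply: is_derive_ln_comp dS.
by rewrite xt0 nested_partition_gt0.
Qed.

Lemma grad_conjugate_nested_entropy x :
  grad_conjugate (nested_entropy zeta eta nu) x =1
  state_marginal (nested_tilt x).
Proof.
move=> theta; rewrite /grad_conjugate /gradient derive1E.
under eq_fun do rewrite /= conjugate_nested_entropy /=.
exact: (derive_val (is_derive := is_derive_ln_nested_partition x theta)).
Qed.

End NestedConjugate.

(** * The optimal joint belief behind a chosen action *)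

Theorem proposition14 (R : realType) (Theta N : finType)
    (pi : Theta -> R) (A : {fset {ffun Theta -> R}}) (nu : N * Theta -> R)
    (zeta eta : R) (P : Theta -> A -> R) (lambda : Theta -> R) (a : A) :
  decision_problem pi A ->
  nest_structure pi nu ->
  0 < zeta -> 0 < eta ->
  is_optimal pi (nested_entropy zeta eta nu) P ->
  generated_by pi (nested_entropy zeta eta nu) P (choice_marginal pi P) lambda ->
  0 < choice_marginal pi P a ->
  let nubar := nest_marginal nu in
  let nu_ := nest_conditional nu in
  let lambda_pi := normalized pi lambda in
  let p_a := posterior pi P a in
  let w tau := expR ((val a tau - lambda_pi tau) / eta) in
  exists mu_a : N * Theta -> R,
    [/\ is_dist mu_a /\ state_marginal mu_a =1 p_a,
        nested_cost zeta eta nu mu_a = nested_entropy zeta eta nu p_a,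
        forall i, nest_marginal mu_a i =
          nubar i * (\sum_tau nu_ i tau * w tau) `^ (eta / zeta) /
          \sum_j nubar j * (\sum_tau nu_ j tau * w tau) `^ (eta / zeta)
      & forall i theta, nest_conditional mu_a i theta =
          nu_ i theta * w theta / \sum_tau nu_ i tau * w tau].
Proof.
move=> [_ pi_gt0 _] [dnu fnu _] zeta_gt0 eta_gt0 _ genP Pa_gt0.
move=> nubar nu_ lambda_pi p_a w.
pose x := shifted_payoff pi a lambda.
(* The saddle point enters only here: it makes [p_a] a gradient of the conjugate, hence a marginal
   at which [nested_entropy_tilt] gives attainment. *)
have p_aE : p_a = state_marginal (nested_tilt nu zeta eta x).
  apply/funext => theta; rewrite /p_a (posterior_grad pi_gt0 genP Pa_gt0).
  exact: grad_conjugate_nested_entropy.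
have expE i : expR (nest_value nu zeta eta x i) =
    (\sum_tau nu_ i tau * w tau) `^ (eta / zeta).
  (* [powR] treats base 0 separately; positivity of the nest partition selects the [expR] branch. *)
  by rewrite /powR ifF// gt_eqF//; exact: nest_partition_gt0.
exists (nested_tilt nu zeta eta x); rewrite p_aE; split.
- by split=> //; exact: nested_tilt_dist.
- by rewrite nested_entropy_tilt.
- move=> i; rewrite nest_marginal_tilt// /tilt /partition expE.
  by congr (_ / _); apply: eq_bigr => j _; rewrite expE.
- by move=> i theta; rewrite nest_conditional_tilt.
Qed.
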